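(* For all $q\ge1$, $0\le c\le 1/q$ and $J\in\mathrm{Sym}_q$, the simple graph parameter $f(G)=\hat{\mathcal{E}}^{c}(G,J)$ is testable. Choosing $J$ appropriately, $f(G)$ can be regarded as a type of balanced multiway minimal cut in the earlier work cited as [BKK].
   Context: Simple graphs are graphs without loops and multiple edges. $q$ is a positive integer, $\mathrm{Sym}_q$ is the set of symmetric $q\times q$ real matrices, $[q]=\{1,\dots,q\}$, and $\mathrm{Pd}_q$ is the set of probability distributions $\mathbf{a}=(a_1,\dots,a_q)$ on $[q]$. For a simple graph $G$ with node set $V(G)$ and edge set $E(G)$, a map $\phi:V(G)\to[q]$ and $J\in\mathrm{Sym}_q$ put $$\mathcal{E}_\phi(G,J)=-\frac{2}{|V(G)|^2}\sum_{uv\in E(G)}J_{\phi(u)\phi(v)} .$$ For $\mathbf{a}\in\mathrm{Pd}_q$ let $\Omega_{\mathbf{a}}(G)=\{\phi:V(G)\to[q] : \bigl||\phi^{-1}(\{i\})|-a_i|V(G)|\bigr|\le1\text{ for all }i\in[q]\}$ and $\hat{\mathcal{E}}_{\mathbf{a}}(G,J)=\min_{\phi\in\Omega_{\mathbf{a}}(G)}\mathcal{E}_\phi(G,J)$. For $0\le c\le1/q$ let $A_c=\{\mathbf{a}\in\mathrm{Pd}_q:a_i\ge c,\ i=1,\dots,q\}$; the lower threshold ground state energy is $\hat{\mathcal{E}}^{c}(G,J)=\inf_{\mathbf{a}\in A_c}\hat{\mathcal{E}}_{\mathbf{a}}(G,J)$. For a graph $G$ and a positive integer $k$, $\mathbb{G}(k,G)$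 denotes the random induced subgraph $G[S]$ where $S$ is chosen uniformly from all subsets of $V(G)$ of cardinality $k$. A real function $f$ defined on the set of simple graphs is a testable simple graph parameter if for every $\varepsilon>0$ there exists $k=k(\varepsilon)\in\mathbb{N}$ such that for every simple graph $G$ on at least $k$ vertices, $P\bigl(|f(G)-f(\mathbb{G}(k,G))|>\varepsilon\bigr)<\varepsilon$. [BKK] is the earlier work in which the testability of minimum balanced multiway cut densities (a problem of cluster analysis) was proved by a different approach. The second sentence of the claim is an informal interpretive statement: the paper does not specify in it which $J$ is chosen, nor does it restate the definition of the balanced multiway cuts of [BKK]. *)

(* Defs.v *)
From HB Require Import structures.
From mathcomp Require Import all_boot all_order all_algebra.
From mathcomp Require Import classical_sets reals.

Set Implicit Arguments.
Unset Strict Implicit.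
Unset Printing Implicit Defensive.

Import Order.TTheory GRing.Theory Num.Theory.

Local Open Scope ring_scope.

Record sgraph := SGraph {
  vertex :> finType;
  adj : rel vertex;
  adj_sym : symmetric adj;
  adj_irr : irreflexive adj }.

Section Induced.
Variables (G : sgraph) (S : {set G}).

Definition induced_vertex : finType := {x : G | x \in S}.

Definition induced_adj : rel induced_vertex :=
  fun x y => adj (val x) (val y).

Lemma induced_adj_sym : symmetric induced_adj.
Proof. by move=> x y; exact: adj_sym. Qed.

Lemma induced_adj_irr : irreflexive induced_adj.
Proof. by move=> x; exact: adj_irr. Qed.

Definition induced : sgraph := SGraph induced_adj_sym induced_adj_irr.
End Induced.

Section Testable.
Variable R : realType.

(* The probability that P holds for a uniformly chosen k-subset of V(G). *)
Definition ksubset_prob (G : sgraph) (k : nat) (P : pred {set G}) : R :=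
  #|[set S : {set G} | (#|S| == k) && P S]|%:R
    / #|[set S : {set G} | #|S| == k]|%:R.

Definition testable (f : sgraph -> R) : Prop :=
  forall eps : R, 0 < eps ->
  exists2 k : nat, (0 < k)%N &
    forall G : sgraph, (k <= #|G|)%N ->
      ksubset_prob k (fun S : {set G} => eps < `|f G - f (induced S)|) < eps.

End Testable.

Section Energy.
Variables (R : realType) (q : nat).

(* Every edge uv arises from the two ordered pairs (u, v) and (v, u), hence
   the halving; this is the sum over E(G) whenever F is symmetric. *)
Definition edge_sum (G : sgraph) (F : G -> G -> R) : R :=
  (\sum_(u : G) \sum_(v : G | adj u v) F u v) / 2.

Definition energy (G : sgraph) (J : 'M[R]_q) (phi : {ffun G -> 'I_q}) : R :=
  - (2 / #|G|%:R ^+ 2) * edge_sum (fun u v => J (phi u) (phi v)).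

Definition color_class (G : sgraph) (phi : {ffun G -> 'I_q}) (i : 'I_q) :
  {set G} := [set u | phi u == i].

Definition Pd : set ('I_q -> R) :=
  [set a | (forall i, 0 <= a i) /\ \sum_(i < q) a i = 1]%classic.

Definition Omega (a : 'I_q -> R) (G : sgraph) : set {ffun G -> 'I_q} :=
  [set phi | forall i, `|#|color_class phi i|%:R - a i * #|G|%:R| <= 1]%classic.

(* For a in Pd, Omega a G is finite and nonempty (round the a_i * |V(G)|
   suitably), so that the infimum is a minimum. *)
Definition microcanonical_energy (a : 'I_q -> R) (G : sgraph) (J : 'M[R]_q) :
  R := inf [set energy J phi | phi in @Omega a G]%classic.

Definition threshold_set (c : R) : set ('I_q -> R) :=
  (Pd `&` [set a | forall i, (c <= a i)%R])%classic.

Definition lower_threshold_energy (c : R) (J : 'M[R]_q) (G : sgraph) : R :=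
  inf [set microcanonical_energy a G J | a in threshold_set c]%classic.

(* Colorings are read as ordered q-partitions of the vertex set.  Class sizes
   need only agree with a c-balanced distribution up to one vertex: exact
   balance may be impossible, e.g. for c = 1 / q when q does not divide
   |V(G)|. *)
Definition balanced (c : R) (G : sgraph) : set {ffun G -> 'I_q} :=
  [set phi | exists2 a, threshold_set c a & Omega a phi]%classic.

Definition edges_between (G : sgraph) (A B : {set G}) : nat :=
  #|[set p : G * G | [&& p.1 \in A, p.2 \in B & adj p.1 p.2]]|.

Definition multiway_cut_density (G : sgraph) (phi : {ffun G -> 'I_q}) : R :=
  (\sum_(i < q) \sum_(j < q | (i < j)%N)
     (edges_between (color_class phi i) (color_class phi j))%:R)
  / #|G|%:R ^+ 2.

Definition is_min_balanced_cut_density (c : R) (G : sgraph) (m : R) : Prop :=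
  (exists2 phi : {ffun G -> 'I_q}, balanced c phi &
     m = multiway_cut_density phi) /\
  (forall phi : {ffun G -> 'I_q}, balanced c phi ->
     m <= multiway_cut_density phi).

End Energy.

(* Main.v *)
Require Import Defs.
From HB Require Import structures.
From mathcomp Require Import boolp classical_sets reals.
From mathcomp Require Import all_boot all_order all_algebra.
From mathcomp Require Import zify ring lra.

(** The ground state energy of a graph depends, up to a small error, only on a
bounded amount of data about it, and a random induced subgraph of bounded size
inherits that data.

The data is a weak regularity partition.  For a matrix [U], let [c4 U] be the
sum of the products of the entries of [U] along all closed walks of length 4
in the associated weighted bipartite graph.  Two applications of the
Cauchy-Schwarz inequality show that a small [c4 U] forces every bilinear form
[sum U x y f x g y] with bounded [f], [g] to be small ([cut_le_c4]); so [c4]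
controls the cut norm, while being a homomorphism density and hence easy to
sample.  An energy increment argument ([regularity]) gives a partition of the
vertices into a bounded number of parts such that the adjacency matrix minus
its averages over the blocks has small [c4].  The refining functions in that
argument are rows and columns of the residual matrix, so that every step of it
splits the parts along the neighbourhoods of two vertices only.

Let [S] be a random [k]-set of vertices.  The restriction of the residual to
[S] has small expected [c4] ([c4_sample]), since a set of four vertices lies in
[S] with probability at most (k/n)^4 and degenerate quadruples are rare; as [c4]
is nonnegative, Markov's inequality suffices.  Chebyshev's inequality shows
that [S] meets every part in about the right proportion ([sample_deviation]).
Both facts together are [sample_bad_le].

It remains to compare two graphs [G] and [H] with partitions indexed by the same
set, in nearly equal proportions, whose residuals with respect to the same
block densities are small ([ground_state_transfer]; it is applied with [H] the
sample, in both directions).  The energy of a coloring then depends, up to a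
small error, only on the proportion of vertices of part [a] and color [i]
([energy_compare]).  An optimal coloring of [H] is copied to [G] by
coloring every part of [G] in the proportions seen in [H], up to rounding
([copy_coloring]).  Its color classes have almost the right sizes, and
recoloring a few vertices makes it balanced ([Omega_approximation]) without
changing the energy much ([energy_recolor]).

For the second claim, [J] equal to -1/2 off the diagonal and 0 on it turns the
energy into the density of edges between different color classes
([energy_cut]). *)

Set Implicit Arguments.
Unset Strict Implicit.
Unset Printing Implicit Defensive.

Import Order.TTheory GRing.Theory Num.Theory.

Local Open Scope ring_scope.

(** * Cycles of length four and bilinear forms *)

Section CutNorm.
Variable R : realFieldType.

(** Cauchy-Schwarz with bounded coefficients [a]: expanding the square, the
cross terms are handled by the arithmetic-geometric mean inequality. *)
Lemma sqr_sum_le (I : finType) (a b : I -> R) :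
  (forall i, `|a i| <= 1) ->
  (\sum_i a i * b i) ^+ 2 <= #|I|%:R * \sum_i b i ^+ 2.
Proof.
move=> a1.
have -> : #|I|%:R * \sum_i b i ^+ 2 =
    \sum_i \sum_j ((b i ^+ 2 + b j ^+ 2) / 2).
  set s := \sum_i b i ^+ 2.
  transitivity (\sum_i (#|I|%:R * (b i ^+ 2 / 2) + s / 2)).
    rewrite big_split /= -mulr_sumr -mulr_suml -/s sumr_const -[s / 2 *+ _]mulr_natl.
    by rewrite -mulrDr -splitr.
  apply: eq_bigr => i _.
  by rewrite -mulr_suml big_split /= -/s sumr_const -[_ *+ #|I|]mulr_natl; ring.
rewrite expr2 big_distrlr /=.
apply: ler_sum => i _; apply: ler_sum => j _.
have h : (a i * a j) ^+ 2 <= 1.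
  by rewrite -real_normK ?num_real ?exprn_ile1 // normrM mulr_ile1.
have := sqr_ge0 (b i - a i * a j * b j); have := sqr_ge0 (b j).
nra.
Qed.

(** Written with codegrees [\sum_y U x y * U x' y], which makes the
nonnegativity visible; [c4E] is the expansion into walks. *)
Definition c4 (V : finType) (U : V -> V -> R) : R :=
  \sum_x \sum_x' (\sum_y U x y * U x' y) ^+ 2.

Lemma c4_ge0 (V : finType) (U : V -> V -> R) : 0 <= c4 U.
Proof. by apply: sumr_ge0 => x _; apply: sumr_ge0 => x' _; exact: sqr_ge0. Qed.

Lemma c4E (V : finType) (U : V -> V -> R) :
  c4 U = \sum_x \sum_x' \sum_y \sum_y' U x y * U x' y * (U x y' * U x' y').
Proof.
by apply: eq_bigr => x _; apply: eq_bigr => x' _; rewrite expr2 big_distrlr.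
Qed.

(** The first Cauchy-Schwarz step removes [g] and produces the codegrees of
[U], the second one removes [f]. *)
Lemma cut_le_c4 (V : finType) (U : V -> V -> R) (f g : V -> R) :
  (forall x, `|f x| <= 1) -> (forall x, `|g x| <= 1) ->
  (\sum_x \sum_y U x y * (f x * g y)) ^+ 4 <= #|V|%:R ^+ 4 * c4 U.
Proof.
move=> f1 g1.
pose s := \sum_y (\sum_x f x * U x y) ^+ 2.
pose T := \sum_x \sum_y U x y * (f x * g y).
have s0 : 0 <= s by apply: sumr_ge0 => y _; exact: sqr_ge0.
have le1 : T ^+ 2 <= #|V|%:R * s.
  have -> : T = \sum_y g y * \sum_x f x * U x y.
    rewrite /T exchange_big; apply: eq_bigr => y _.
    by rewrite mulr_sumr; apply: eq_bigr => x _; ring.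
  exact: sqr_sum_le.
have le2 : s ^+ 2 <= #|V|%:R ^+ 2 * c4 U.
  have -> : s = \sum_(z : V * V) f z.1 * f z.2 * \sum_y U z.1 y * U z.2 y.
    rewrite -(pair_bigA _ (fun x x' => f x * f x' * \sum_y U x y * U x' y)) /=.
    under [RHS]eq_bigr => x _ do
      under eq_bigr => x' _ do rewrite mulr_sumr.
    under [RHS]eq_bigr => x _ do rewrite exchange_big.
    rewrite exchange_big; apply: eq_bigr => y _.
    rewrite expr2 big_distrlr; apply: eq_bigr => x _; apply: eq_bigr => x' _.
    by rewrite /=; ring.
  have -> : #|V|%:R ^+ 2 = #|{: V * V}|%:R :> R by rewrite card_prod natrM.
  have -> : c4 U = \sum_(z : V * V) (\sum_y U z.1 y * U z.2 y) ^+ 2.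
    by rewrite -(pair_bigA _ (fun x x' => (\sum_y U x y * U x' y) ^+ 2)).
  by apply: sqr_sum_le => z; rewrite normrM mulr_ile1.
rewrite -/T (exprM T 2 2).
apply: (@le_trans _ _ ((#|V|%:R * s) ^+ 2)).
  by rewrite ler_sqr ?nnegrE ?sqr_ge0 // mulr_ge0.
rewrite exprMn [leRHS](_ : _ = #|V|%:R ^+ 2 * (#|V|%:R ^+ 2 * c4 U)); last by ring.
by rewrite ler_wpM2l ?sqr_ge0.
Qed.

End CutNorm.

(** * A regularity partition with small residual *)

Section Regularity.
Variables (R : realFieldType) (V : finType) (e : rel V).

Local Notation A x y := ((e x y)%:R : R).

Definition part_size (K : finType) (p : V -> K) (a : K) : nat :=
  #|[set x | p x == a]|.

(** Blocks with an empty side get density 0, by the convention on division. *)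
Definition density (K : finType) (p : V -> K) (a b : K) : R :=
  (\sum_(x | p x == a) \sum_(y | p y == b) A x y) /
    ((part_size p a)%:R * (part_size p b)%:R).

(** [d] need not be the density of [e] itself: later, the densities of a graph
are used for the residual of its sample. *)
Definition residual (K : finType) (p : V -> K) (d : K -> K -> R) (x y : V) : R :=
  A x y - d (p x) (p y).

Lemma part_sum (K : finType) (p : V -> K) (a : K) (z : R) :
  \sum_(x | p x == a) z = (part_size p a)%:R * z.
Proof. by rewrite sumr_const mulr_natl /part_size cardsE. Qed.

Lemma density_ge0 (K : finType) (p : V -> K) a b : 0 <= density p a b.
Proof.
by apply: divr_ge0; rewrite ?mulr_ge0 //; do 2 apply: sumr_ge0 => ? _.
Qed.

Lemma density_le1 (K : finType) (p : V -> K) a b : density p a b <= 1.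
Proof.
have le : \sum_(x | p x == a) \sum_(y | p y == b) A x y <=
    (part_size p a)%:R * (part_size p b)%:R.
  rewrite -part_sum; apply: ler_sum => x _.
  rewrite -[leRHS]mulr1 -part_sum; apply: ler_sum => y _.
  by rewrite lern1 leq_b1.
rewrite /density; set t := _ * _ in le *.
have [->|t0] := eqVneq t 0; first by rewrite invr0 mulr0.
by rewrite ler_pdivrMr ?mul1r // lt0r t0 /t mulr_ge0.
Qed.

Lemma residual_le1 (K : finType) (p : V -> K) (d : K -> K -> R) x y :
  (forall a b, 0 <= d a b <= 1) -> `|residual p d x y| <= 1.
Proof.
move=> d01; rewrite /residual ler_norml; have := d01 (p x) (p y).
by move=> /andP[? ?]; case: (e x y) => /=; apply/andP; split; lra.
Qed.

(** Averages over blocks are the orthogonal projection onto functions that are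
constant on blocks. *)
Lemma residual_orthogonal (K : finType) (p : V -> K) (h : K -> K -> R) :
  \sum_x \sum_y residual p (density p) x y * h (p x) (p y) = 0.
Proof.
under eq_bigr => x _ do rewrite (partition_big p xpredT) //=.
rewrite (partition_big p xpredT) //= big1 // => a _.
rewrite exchange_big /= big1 // => b _.
pose t := \sum_(x | p x == a) \sum_(y | p y == b) A x y.
transitivity (h a b * (t - (part_size p a)%:R *
    ((part_size p b)%:R * density p a b))).
  rewrite -!part_sum -sumrB mulr_sumr; apply: eq_bigr => x /eqP xa.
  rewrite -sumrB mulr_sumr; apply: eq_bigr => y /eqP yb.
  by rewrite /residual xa yb mulrC.
have [P0|P0] := eqVneq ((part_size p a)%:R * (part_size p b)%:R : R) 0.
  have -> : t = 0.
    move/eqP: P0; rewrite mulf_eq0 !pnatr_eq0.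
    have E c : part_size p c == 0%N -> forall x, (p x == c) = false.
      by rewrite cards_eq0 => /eqP/setP cE x; have := cE x; rewrite !inE.
    case/orP => /E H; rewrite /t.
      by rewrite big1 // => x; rewrite H.
    by rewrite big1 // => x _; rewrite big1 // => y; rewrite H.
  by rewrite mulrA P0 mul0r subr0 mulr0.
by rewrite mulrA /density -/t mulrC mulrC mulrCA divff // mulr1 subrr mulr0.
Qed.

Definition l2_defect (K : finType) (p : V -> K) (d : K -> K -> R) : R :=
  \sum_x \sum_y residual p d x y ^+ 2.

Lemma density_best (K : finType) (p : V -> K) (h : K -> K -> R) :
  l2_defect p (density p) <= l2_defect p h.
Proof.
have := residual_orthogonal p (fun a b => 2 * (density p a b - h a b)).
rewrite -[leLHS]addr0 => <-; rewrite -big_split; apply: ler_sum => x _.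
rewrite -big_split; apply: ler_sum => y _.
have := sqr_ge0 (density p (p x) (p y) - h (p x) (p y)).
by rewrite /residual /=; nra.
Qed.

(** Expanding [c4 U] over the closed walks and fixing one edge [x' y'] of the
walk exhibits it as an average of bilinear forms of [U] in the functions
[fun x => U x y'] and [fun y => U x' y].  If [c4 U] is large, one of these forms
is large, so that subtracting a multiple of the rank-one function improves the
approximation; and that function is constant on blocks once the parts have been
split along the neighbourhoods of [x'] and [y']. *)
Lemma c4_refine (K : finType) (p : V -> K) (eta : R) : 0 < eta ->
  eta * #|V|%:R ^+ 4 < c4 (residual p (density p)) ->
  exists (p' : V -> K * (bool * bool)),
   l2_defect p' (density p') <=
     l2_defect p (density p) - eta ^+ 2 * #|V|%:R ^+ 2.
Proof.
move=> eta0; set d := density p; set U := residual p d => c4gt.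
have U1 x y : `|U x y| <= 1.
  by apply: residual_le1 => a b; rewrite density_ge0 density_le1.
pose S x' y' := \sum_x \sum_y U x y * (U x y' * U x' y).
have [[x' y'] /= Sgt] : exists z : V * V, eta * #|V|%:R ^+ 2 < `|S z.1 z.2|.
  apply/existsP; rewrite -[X in is_true X]negbK; apply/negP => /existsPn Sle.
  move: c4gt; rewrite ltNge => /negP; apply.
  have -> : c4 U = \sum_x' \sum_y' U x' y' * S x' y'.
    rewrite c4E exchange_big; apply: eq_bigr => x' _ /=.
    transitivity (\sum_x \sum_y' \sum_y U x' y' * (U x y * (U x y' * U x' y))).
      apply: eq_bigr => x _; rewrite exchange_big.
      by apply: eq_bigr => y _; apply: eq_bigr => y' _; ring.
    rewrite exchange_big; apply: eq_bigr => y' _; rewrite mulr_sumr.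
    by apply: eq_bigr => x _; rewrite mulr_sumr.
  have -> : eta * #|V|%:R ^+ 4 = \sum_(x' : V) \sum_(y' : V) eta * #|V|%:R ^+ 2.
    by rewrite !sumr_const -mulrnA -[RHS]mulr_natr natrM; ring.
  apply: ler_sum => x' _; apply: ler_sum => y' _.
  have := Sle (x', y'); rewrite -leNgt /= => Sle'.
  apply: le_trans (ler_norm _) _; rewrite normrM.
  by apply: le_trans Sle'; rewrite ler_piMl.
pose p' x := (p x, (e x y', e x' x)).
exists p'.
(* The step [eta] optimizes the gain [2 * c * S - c ^+ 2 * n ^+ 2]. *)
pose c := if 0 <= S x' y' then eta else - eta.
have cS : c * S x' y' = eta * `|S x' y'|.
  rewrite /c; case: (lerP 0 (S x' y')) => s0.
    by rewrite ger0_norm.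
  by rewrite ltr0_norm // mulrN mulNr.
have c2 : c ^+ 2 = eta ^+ 2 by rewrite /c; case: ifP => // _; rewrite sqrrN.
pose h (a b : K * (bool * bool)) : R := d a.1 b.1 +
  c * ((a.2.1%:R - d a.1 (p y')) * (b.2.2%:R - d (p x') b.1)).
apply: le_trans (density_best p' h) _.
have -> : l2_defect p' h =
    \sum_x \sum_y (U x y - c * (U x y' * U x' y)) ^+ 2.
  apply: eq_bigr => x _; apply: eq_bigr => y _.
  by rewrite /residual /h /= /U /residual opprD addrA.
have -> : \sum_x \sum_y (U x y - c * (U x y' * U x' y)) ^+ 2 =
    l2_defect p d - 2 * (c * S x' y') +
     \sum_x \sum_y c ^+ 2 * (U x y' * U x' y) ^+ 2.
  rewrite /S mulrA mulr_sumr -sumrB -big_split; apply: eq_bigr => x _ /=.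
  rewrite mulr_sumr -sumrB -big_split; apply: eq_bigr => y _ /=.
  by rewrite -/U; ring.
have le2 : \sum_x \sum_y c ^+ 2 * (U x y' * U x' y) ^+ 2 <=
    eta ^+ 2 * #|V|%:R ^+ 2.
  have -> : eta ^+ 2 * #|V|%:R ^+ 2 = \sum_(x' : V) \sum_(y' : V) eta ^+ 2.
    by rewrite !sumr_const -mulrnA -[RHS]mulr_natr natrM; ring.
  apply: ler_sum => x _; apply: ler_sum => y _; rewrite c2.
  rewrite ler_piMr ?sqr_ge0 // -real_normK ?num_real ?exprn_ile1 //.
  by rewrite normrM mulr_ile1.
rewrite cS; nra.
Qed.

(** The squared L2 distance starts at most at n^2 and loses eta^2 n^2 at every
refinement. *)
Lemma regularity (eta : R) (m : nat) : 0 < eta -> 1 < m%:R * eta ^+ 2 ->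
  exists (K : finType) (p : V -> K), (#|K| <= 4 ^ m)%N /\
   c4 (residual p (density p)) <= eta * #|V|%:R ^+ 4.
Proof.
move=> eta0 meta.
suff: exists (K : finType) (p : V -> K), (#|K| <= 4 ^ m)%N /\
   (c4 (residual p (density p)) <= eta * #|V|%:R ^+ 4 \/
    l2_defect p (density p) <= (1 - m%:R * eta ^+ 2) * #|V|%:R ^+ 2).
  move=> [K [p [Km [c4le|gap]]]]; exists K, p; split=> //.
  have V0 : #|V|%:R = 0 :> R.
    have gap0 : 0 <= l2_defect p (density p).
      by apply: sumr_ge0 => x _; apply: sumr_ge0 => y _; exact: sqr_ge0.
    apply/eqP; have [//|V0] := eqVneq (#|V|%:R : R) 0.
    have : 0 < (m%:R * eta ^+ 2 - 1) * #|V|%:R ^+ 2.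
      by rewrite mulr_gt0 ?subr_gt0 // exprn_gt0 // lt0r V0 /=.
    by lra.
  rewrite V0 expr0n /= mulr0 /c4 big1 // => x.
  by move/eqP: V0; rewrite pnatr_eq0 => /eqP/card0_eq/(_ x).
elim: m {meta} => [|m [K [p [Km [c4le|gap]]]]].
- exists unit, (fun=> tt); split; first by rewrite card_unit.
  right; rewrite mul0r subr0 mul1r.
  have -> : #|V|%:R ^+ 2 = \sum_(x' : V) \sum_(y' : V) 1 :> R.
    by rewrite !sumr_const -mulrnA natrM expr2.
  apply: ler_sum => x _; apply: ler_sum => y _.
  rewrite -real_normK ?num_real ?exprn_ile1 //.
  by apply: residual_le1 => a b; rewrite density_ge0 density_le1.
- exists K, p; split; last by left.
  by apply: leq_trans Km _; rewrite leq_exp2l.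
- have [c4le|c4gt] := lerP (c4 (residual p (density p))) (eta * #|V|%:R ^+ 4).
    exists K, p; split; last by left.
    by apply: leq_trans Km _; rewrite leq_exp2l.
  have [p' gap'] := c4_refine eta0 c4gt.
  exists _, p'; split.
    by rewrite card_prod card_prod card_bool expnSr leq_mul2r Km orbT.
  right; apply: le_trans gap' _; rewrite -natr1; lra.
Qed.

End Regularity.

(** * Sampling a uniform subset of fixed size *)

Lemma sum_indicator (R : realFieldType) (I : finType) (D P : pred I) :
  \sum_(x | D x) (P x)%:R = #|[set x | D x && P x]|%:R :> R.
Proof.
rewrite -sum1_card natr_sum [RHS](eq_bigl (fun x => D x && P x)); last first.
  by move=> x; rewrite inE.
by rewrite big_mkcondr; apply: eq_bigr => x _; case: (P x).
Qed.

Section Sampling.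
Variables (R : realFieldType) (V : finType) (k : nat).
Hypotheses (k_gt0 : (0 < k)%N) (k_le : (k <= #|V|)%N).

Definition samples : {set {set V}} := [set S : {set V} | #|S| == k].

(** The number of [k]-sets containing a given set of size [j]. *)
Definition superset_count (j : nat) : nat :=
  if (j <= k)%N then 'C(#|V| - j, k - j) else 0%N.

Lemma card_samples : #|samples| = 'C(#|V|, k).
Proof.
rewrite -cardsT -cards_draws; apply: eq_card => S.
by rewrite !inE subsetT.
Qed.

Lemma card_supersets (T : {set V}) :
  #|[set S in samples | T \subset S]| = superset_count #|T|.
Proof.
rewrite /superset_count; case: leqP => Tk; last first.
  apply: eq_card0 => S; rewrite !inE; apply/negP => /andP[/eqP Sk /subset_leq_card].
  by rewrite Sk leqNgt Tk.
have -> : (#|V| - #|T|)%N = #|~: T| by rewrite [RHS]cardsCs setCK.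
rewrite -cards_draws.
have inj : {in [set A : {set V} | A \subset ~: T & #|A| == (k - #|T|)%N] &,
    injective (fun A => A :|: T)}.
  move=> A B; rewrite !inE -!disjoints_subset => /andP[dA _] /andP[dB _] eAB.
  have K (C : {set V}) : [disjoint C & T] -> (C :|: T) :\: T = C.
    by move=> dC; rewrite setDUl setDv setU0; apply/setDidPl.
  by rewrite -(K A) // -(K B) // eAB.
rewrite -(card_in_imset inj); apply: eq_card => S; rewrite !inE.
apply/andP/imsetP => [[/eqP Sk TS]|[A + ->]].
  exists (S :\: T); last first.
    apply/setP => x; rewrite !inE.
    by case: (boolP (x \in T)) => [/(subsetP TS) ->|_]; rewrite ?orbF.
  by rewrite inE subDset setUCr subsetT cardsDS // Sk eqxx.
rewrite inE -disjoints_subset => /andP[dA /eqP Ak].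
by rewrite cardsU (disjoint_setI0 dA) cards0 subn0 Ak subnK // subsetUr.
Qed.

(** Every further prescribed element costs a factor (k-j)/(n-j) <= k/n. *)
Lemma superset_count_le (j : nat) :
  (superset_count j * #|V| ^ j <= k ^ j * #|samples|)%N.
Proof.
rewrite card_samples; elim: j => [|j IH].
  by rewrite /superset_count !subn0 muln1 mul1n.
have step : (superset_count j.+1 * #|V| <= k * superset_count j)%N.
  rewrite /superset_count; case: ltnP => // jk; rewrite (ltnW jk).
  have jV : (0 < #|V| - j)%N by rewrite subn_gt0 (leq_trans jk k_le).
  rewrite -(leq_pmul2l jV).
  have := mul_bin_diag (#|V| - j) (k - j.+1).
  rewrite -subnS; have -> : (k - j.+1).+1 = (k - j)%N by lia.
  move=> E; rewrite mulnA E mulnAC mulnA leq_mul2r; apply/orP; right.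
  by rewrite !mulnBl [(k * _)%N]mulnC leq_sub2l // leq_mul2l k_le orbT.
rewrite !expnS mulnA -[(k * _ * _)%N]mulnA.
apply: leq_trans (_ : _ <= k * superset_count j * #|V| ^ j)%N _.
  by rewrite leq_mul2r step orbT.
by rewrite -mulnA leq_mul2l IH orbT.
Qed.

Lemma superset_prob_le (j : nat) :
  (superset_count j)%:R <= (k%:R / #|V|%:R) ^+ j * #|samples|%:R :> R.
Proof.
have V0 : 0 < #|V|%:R :> R by rewrite ltr0n (leq_trans k_gt0).
rewrite exprMn exprVn mulrAC ler_pdivlMr ?exprn_gt0 //.
by rewrite -!natrX -!natrM ler_nat superset_count_le.
Qed.

(** The number of samples containing the entries of a repetition-free tuple
depends on its length only, so that summing over samples rescales such sums. *)
Lemma sample_moment (Q : finType) (pts : Q -> seq V) (j : nat) (F : Q -> R) :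
  (forall z, size (pts z) = j) ->
  \sum_(S in samples) \sum_(z | all (mem S) (pts z) && uniq (pts z)) F z =
  (superset_count j)%:R * \sum_(z | uniq (pts z)) F z.
Proof.
move=> sz.
under eq_bigr => S _ do under eq_bigl => z do rewrite andbC.
under eq_bigr => S _ do rewrite big_mkcondr.
rewrite exchange_big mulr_sumr; apply: eq_bigr => z uz.
rewrite -big_mkcondr /= sumr_const -[LHS]mulr_natl; congr (_%:R * _).
have <- : #|[set x in pts z]| = j by rewrite cardsE (card_uniqP uz).
rewrite -card_supersets; apply: eq_card => S; rewrite [RHS]inE -topredE /=; congr (_ && _).
apply/allP/subsetP => H x; last by move=> xz; apply: H; rewrite inE.
by rewrite inE; exact: H.
Qed.

(** Variance of the size of the intersection with [P].  The centered indicator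
of [P] has sum zero over all vertices, hence its off-diagonal pairs have
negative total weight, and only the diagonal contributes. *)
Lemma sample_deviation (P : pred V) :
  \sum_(S in samples)
    (#|[set x in S | P x]|%:R - k%:R * (#|[set x | P x]|%:R / #|V|%:R)) ^+ 2 <=
  k%:R * #|samples|%:R :> R.
Proof.
have V0 : 0 < #|V|%:R :> R by rewrite ltr0n (leq_trans k_gt0).
set m := #|[set x | P x]|%:R / #|V|%:R : R.
pose f x : R := (P x)%:R - m.
have fsum : \sum_x f x = 0.
  rewrite sumrB sumr_const -[m *+ _]mulr_natl /m mulrCA divff ?gt_eqF // mulr1.
  by rewrite (sum_indicator _ xpredT) subrr.
have m01 : 0 <= m <= 1.
  rewrite divr_ge0 //= ler_pdivrMr // mul1r ler_nat; exact: max_card.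
have f1 x : f x ^+ 2 <= 1.
  rewrite -real_normK ?num_real // exprn_ile1 // ler_norml /f.
  by case: (P x) => /=; apply/andP; split; lra.
pose pts (z : V * V) := [:: z.1; z.2].
have key S : S \in samples ->
    (#|[set x in S | P x]|%:R - k%:R * m) ^+ 2 =
    \sum_(x in S) f x ^+ 2 +
    \sum_(z | all (mem S) (pts z) && uniq (pts z)) f z.1 * f z.2.
  rewrite inE => /eqP Sk.
  have -> : #|[set x in S | P x]|%:R - k%:R * m = \sum_(x in S) f x.
    rewrite sumrB sumr_const Sk mulr_natl; congr (_ - _).
    by rewrite (sum_indicator _ (mem S)).
  rewrite expr2 big_distrlr /=.
  under eq_bigr => x xS do rewrite (bigD1 x) //= -expr2.
  rewrite big_split /= pair_big_dep /=; congr (_ + _).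
  by apply: eq_bigl => z; rewrite /= inE !andbT eq_sym andbA.
rewrite (eq_bigr _ key) big_split (@sample_moment _ pts 2 (fun z => f z.1 * f z.2)) //.
have -> : \sum_(z | uniq (pts z)) f z.1 * f z.2 = - \sum_x f x ^+ 2.
  have : (\sum_x f x) * (\sum_x f x) = 0 by rewrite fsum mulr0.
  rewrite big_distrlr /=.
  under eq_bigr => x _ do rewrite (bigD1 x) //= -expr2.
  rewrite big_split /= pair_big_dep /= addrC => /eqP; rewrite addr_eq0 => /eqP <-.
  by apply: eq_bigl => z; rewrite /= inE andbT eq_sym.
rewrite mulrN; apply: le_trans (_ : _ <= \sum_(S in samples) k%:R) _.
  rewrite lerBlDr -[leLHS]addr0 lerD //; last first.
    by rewrite mulr_ge0 ?sumr_ge0 // => x _; exact: sqr_ge0.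
  apply: ler_sum => S; rewrite inE => /eqP <-.
  by rewrite -sum1_card natr_sum; apply: ler_sum => x _.
by rewrite sumr_const mulr_natr.
Qed.

End Sampling.

(** * The residual of a sample *)

Section Quadruples.
Variables (R : realFieldType) (V : finType).

Definition corners (z : (V * V) * (V * V)) : seq V :=
  [:: z.1.1; z.1.2; z.2.1; z.2.2].

Definition corner_prod (U : V -> V -> R) (z : (V * V) * (V * V)) : R :=
  U z.1.1 z.2.1 * U z.1.2 z.2.1 * (U z.1.1 z.2.2 * U z.1.2 z.2.2).

Lemma c4_restrict (U : V -> V -> R) (S : {set V}) :
  c4 (fun x y : {x | x \in S} => U (val x) (val y)) =
  \sum_(z | all (mem S) (corners z)) corner_prod U z.
Proof.
rewrite c4E.
transitivity (\sum_(x in S) \sum_(x' in S) \sum_(y in S) \sum_(y' in S)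
    U x y * U x' y * (U x y' * U x' y')).
  do 4 (rewrite [RHS]big_sub; apply: eq_bigr => ? _).
  by [].
rewrite pair_big_dep /=.
under eq_bigr => z _ do rewrite pair_big_dep /=.
rewrite pair_big_dep /=.
by apply: eq_bigl => z; rewrite /= andbT !andbA.
Qed.

Lemma c4_corners (U : V -> V -> R) : c4 U = \sum_z corner_prod U z.
Proof.
rewrite c4E pair_big /=.
under eq_bigr => z _ do rewrite pair_big /=.
by rewrite pair_big.
Qed.

(** Two of the four coordinates can coincide in six ways, each of which leaves
three free vertices. *)
Lemma card_degenerate (S : {set V}) :
  (#|[set z | all (mem S) (corners z) && ~~ uniq (corners z)]| <= 6 * #|S| ^ 3)%N.
Proof.
pose T := setX (setX S S) S.
have T3 : #|T| = (#|S| ^ 3)%N by rewrite !cardsX !expnS muln1 mulnA.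
pose g1 (t : V * V * V) := ((t.1.1, t.1.1), (t.1.2, t.2)).
pose g2 (t : V * V * V) := ((t.1.1, t.1.2), (t.1.1, t.2)).
pose g3 (t : V * V * V) := ((t.1.1, t.1.2), (t.2, t.1.1)).
pose g4 (t : V * V * V) := ((t.1.1, t.1.2), (t.1.2, t.2)).
pose g5 (t : V * V * V) := ((t.1.1, t.1.2), (t.2, t.1.2)).
pose g6 (t : V * V * V) := ((t.1.1, t.1.2), (t.2, t.2)).
have sub : [set z | all (mem S) (corners z) && ~~ uniq (corners z)] \subset
    (g1 @: T) :|: (g2 @: T) :|: (g3 @: T) :|: (g4 @: T) :|: (g5 @: T) :|: (g6 @: T).
  apply/subsetP => -[[x x'] [y y']]; rewrite !inE /= !inE.
  rewrite !andbT !negb_and !negbK.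
  move=> /andP[/and4P[xS x'S yS y'S]].
  have I g (t : V * V * V) (z : (V * V) * (V * V)) : t \in T -> g t = z -> z \in g @: T.
    by move=> tT <-; apply/imsetP; exists t.
  case/orP => [/or3P[]|/orP[/orP[]|]] /eqP <-.
  - by rewrite (I g1 (x, y, y')) // !inE xS yS y'S.
  - by rewrite (I g2 (x, x', y')) ?orbT // !inE xS x'S y'S.
  - by rewrite (I g3 (x, x', y)) ?orbT // !inE xS x'S yS.
  - by rewrite (I g4 (x, x', y')) ?orbT // !inE xS x'S y'S.
  - by rewrite (I g5 (x, x', y)) ?orbT // !inE xS x'S yS.
  - by rewrite (I g6 (x, x', y)) ?orbT // !inE xS x'S yS.
apply: leq_trans (subset_leq_card sub) _.
have L (g : V * V * V -> (V * V) * (V * V)) : (#|g @: T| <= #|S| ^ 3)%N.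
  by rewrite -T3; exact: leq_imset_card.
have -> : (6 * #|S| ^ 3 = #|S| ^ 3 + #|S| ^ 3 + #|S| ^ 3 + #|S| ^ 3 +
  #|S| ^ 3 + #|S| ^ 3)%N by lia.
do 5 (apply: leq_trans (leq_card_setU _ _) _; apply: leq_add; last exact: L).
exact: L.
Qed.

Lemma degenerate_le (U : V -> V -> R) (S : {set V}) :
  (forall x y, `|U x y| <= 1) ->
  `|\sum_(z | all (mem S) (corners z) && ~~ uniq (corners z)) corner_prod U z| <=
  6 * #|S|%:R ^+ 3.
Proof.
move=> U1; apply: le_trans (ler_norm_sum _ _ _) _.
apply: (@le_trans _ _ (\sum_(z | all (mem S) (corners z) && ~~ uniq (corners z)) 1)).
  by apply: ler_sum => z _; rewrite /corner_prod !normrM !mulr_ile1 ?mulr_ge0.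
rewrite sumr_const -natrX -natrM ler_nat.
by apply: leq_trans (card_degenerate S); rewrite cardsE.
Qed.

(** Repetition-free quadruples survive with probability at most (k/n)^4; the
other ones number at most 6k^3 in a sample and 6n^3 in total. *)
Lemma c4_sample (k : nat) (U : V -> V -> R) (eta : R) :
  (0 < k)%N -> (k <= #|V|)%N -> (forall x y, `|U x y| <= 1) ->
  c4 U <= eta * #|V|%:R ^+ 4 ->
  \sum_(S in samples V k) c4 (fun x y : {x | x \in S} => U (val x) (val y)) <=
  (eta * k%:R ^+ 4 + 12 * k%:R ^+ 3) * #|samples V k|%:R.
Proof.
move=> k0 kV U1 c4U.
have V0 : 0 < #|V|%:R :> R by rewrite ltr0n (leq_trans k0).
under eq_bigr => S _.
  rewrite c4_restrict (bigID (fun z => uniq (corners z))) /=.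
  over.
rewrite big_split (@sample_moment _ _ k _ corners 4 (corner_prod U)) //.
set N := #|samples V k|%:R : R.
have N0 : 0 <= N by [].
have le1 : \sum_(S in samples V k) \sum_(z | all (mem S) (corners z) &&
    ~~ uniq (corners z)) corner_prod U z <= 6 * k%:R ^+ 3 * N.
  rewrite [leRHS]mulr_natr -sumr_const; apply: ler_sum => S; rewrite inE => /eqP <-.
  exact: le_trans (ler_norm _) (degenerate_le _ U1).
have le2 : \sum_(z | uniq (corners z)) corner_prod U z <=
    eta * #|V|%:R ^+ 4 + 6 * #|V|%:R ^+ 3.
  have := degenerate_le [set: V] U1.
  rewrite cardsT; set D := \sum_(z | _) _.
  have : c4 U = \sum_(z | uniq (corners z)) corner_prod U z + D.
    rewrite c4_corners (bigID (fun z => uniq (corners z))) /=; congr (_ + _).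
    by apply: eq_bigl => z; rewrite /= !in_setT.
  by rewrite ler_norml => E /andP[? _]; lra.
have e0 : 0 <= eta * #|V|%:R ^+ 4 + 6 * #|V|%:R ^+ 3.
  rewrite addr_ge0 ?(le_trans (c4_ge0 U) c4U) // mulr_ge0 ?exprn_ge0 //.
have le3 := superset_prob_le R k0 kV 4.
have le4 : (superset_count V k 4)%:R * \sum_(z | uniq (corners z)) corner_prod U z
    <= (eta * k%:R ^+ 4 + 6 * k%:R ^+ 3) * N.
  apply: le_trans (ler_wpM2l _ le2) _ => //.
  apply: le_trans (ler_wpM2r e0 le3) _.
  rewrite -/N mulrAC ler_wpM2r // mulrDr expr_div_n.
  set v := #|V|%:R in V0 *; set w := k%:R : R.
  have -> : w ^+ 4 / v ^+ 4 * (eta * v ^+ 4) = eta * w ^+ 4.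
    by field; rewrite gt_eqF.
  have -> : w ^+ 4 / v ^+ 4 * (6 * v ^+ 3) = 6 * w ^+ 3 * (w / v).
    by field; rewrite gt_eqF.
  rewrite lerD2l ler_piMr ?mulr_ge0 ?exprn_ge0 //.
  by rewrite ler_pdivrMr // mul1r ler_nat.
apply: le_trans (lerD le4 le1) _.
by rewrite -mulrDl; apply: ler_wpM2r => //; lra.
Qed.

End Quadruples.

(** * Prescribing the sizes of color classes *)

Section Recoloring.
Variables (V C : finType).

Lemma sum_class (D : {set V}) (phi : V -> C) :
  (\sum_i #|[set u in D | phi u == i]| = #|D|)%N.
Proof.
rewrite -sum1_card (partition_big phi xpredT) //=; apply: eq_bigr => i _.
by rewrite -sum1_card; apply: eq_bigl => u; rewrite inE.
Qed.

(** As the prescribed sizes have the right total, whenever some class is too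
large another one is too small, and moving one vertex between them lowers the
total excess. *)
Lemma recolor (D : {set V}) (phi : {ffun V -> C}) (m : C -> nat) :
  (\sum_i m i = #|D|)%N ->
  exists2 psi : {ffun V -> C},
    forall i, #|[set u in D | psi u == i]| = m i &
    (#|[set u in D | psi u != phi u]| <=
       \sum_i (#|[set u in D | phi u == i]| - m i))%N.
Proof.
move=> sm; have [N] := ubnP (\sum_i (#|[set u in D | phi u == i]| - m i))%N.
elim: N phi => // N IH phi; set c := fun i => #|[set u in D | phi u == i]|.
rewrite -/(c _) => leN.
have sc : (\sum_i c i = #|D|)%N by exact: sum_class.
have [/forallP cm|] := boolP [forall i, c i <= m i]%N.
  exists phi => [i|].
    apply/eqP; rewrite -/(c i).
    have := (@leqif_sum _ xpredT (fun i => c i == m i) c m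
       (fun i _ => leqif_eq (cm i))).
    by rewrite sc sm => -[_]; rewrite eqxx => /esym/forallP/(_ i).
  have -> : #|[set u in D | phi u != phi u]| = 0%N.
    by apply: eq_card0 => u; rewrite !inE eqxx andbF.
  by [].
rewrite negb_forall => /existsP[i]; rewrite -ltnNge => mi.
have [j mj] : exists j, (c j < m j)%N.
  apply/existsP; apply: contraT; rewrite negb_exists => /forallP H.
  have : (\sum_i m i < \sum_i c i)%N.
    rewrite (bigD1 i) //= [X in (_ < X)%N](bigD1 i) //= -addSn leq_add //.
    by apply: leq_sum => l _; rewrite leqNgt H.
  by rewrite sc sm ltnn.
have ij : i != j by apply: contraL mi => /eqP ->; rewrite -leqNgt ltnW.
have [u] : exists u, u \in [set u in D | phi u == i].
  by apply/card_gt0P; apply: leq_ltn_trans mi.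
rewrite inE => /andP[uD /eqP ui].
pose phi' := [ffun v => if v == u then j else phi v].
have c'i : (#|[set v in D | phi' v == i]|.+1 = c i)%N.
  rewrite /c [RHS](cardsD1 u) !inE uD ui eqxx add1n; congr _.+1.
  apply: eq_card => v; rewrite !inE ffunE.
  by case: (eqVneq v u) => [->|] //=; rewrite eq_sym (negPf ij) andbF.
have c'l l : l != i -> (#|[set v in D | phi' v == l]| - m l <= c l - m l)%N.
  have [-> _|lj li] := eqVneq l j.
    suff : (#|[set v in D | phi' v == j]| <= (c j).+1)%N by lia.
    rewrite (cardsD1 u) -add1n leq_add ?leq_b1 //; apply: subset_leq_card.
    apply/subsetP => v; rewrite !inE ffunE.
    by case: (eqVneq v u).
  apply: leq_sub2r; apply: subset_leq_card; apply/subsetP => v; rewrite !inE ffunE.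
  by case: (eqVneq v u) => [_|] //; rewrite eq_sym (negPf lj) andbF.
have dec : (\sum_l (#|[set v in D | phi' v == l]| - m l) <
    \sum_l (c l - m l))%N.
  rewrite (bigD1 i) //= [X in (_ < X)%N](bigD1 i) //= -addSn leq_add //.
    by move: c'i mi; rewrite /c => <-; rewrite ltnS => /subSn ->.
  by apply: leq_sum => l; exact: c'l.
have [|psi psim chg] := IH phi'; first by apply: leq_trans dec _; rewrite -ltnS.
exists psi => //.
apply: leq_trans (_ : _ <= #|[set v in D | psi v != phi' v]|.+1)%N _.
  rewrite -add1n -(cards1 u); apply: leq_trans (leq_card_setU _ _).
  apply: subset_leq_card; apply/subsetP => v; rewrite !inE ffunE.
  by case: (eqVneq v u).
exact: leq_ltn_trans dec.
Qed.

End Recoloring.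

Section Rounding.
Variables (R : realType) (q : nat).

(** Rounding down the cumulative sums keeps the total exact, and every
individual difference changes by less than 1. *)
Lemma round_distribution (y : 'I_q -> R) (N : nat) :
  (forall i, 0 <= y i) -> \sum_i y i = 1 ->
  exists2 m : 'I_q -> nat, (\sum_i m i = N)%N &
    forall i, `|(m i)%:R - y i * N%:R| <= 1.
Proof.
move=> y0 y1.
pose Y (j : nat) := N%:R * \sum_(i < q | (i < j)%N) y i.
have Y0 j : 0 <= Y j by rewrite mulr_ge0 ?sumr_ge0.
pose t j := Num.truncn (Y j).
have YS (i : 'I_q) : Y i.+1 = Y i + y i * N%:R.
  rewrite /Y (bigD1 i) //= mulrDr addrC mulrC [y i * _]mulrC; congr (_ + _).
  rewrite mulrC; congr (_ * _); apply: eq_bigl => l.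
  by rewrite ltnS [RHS]ltn_neqAle andbC.
have tE j : (t j)%:R <= Y j < (t j).+1%:R by exact: truncn_itv.
have tS (i : 'I_q) : (t i <= t i.+1)%N.
  by apply: le_truncn; rewrite YS lerDl mulr_ge0.
have t0 : t 0%N = 0%N by rewrite /t /Y big_pred0 // mulr0 truncn0.
have tq : t q = N.
  rewrite /t /Y (eq_bigl xpredT) ?y1 ?mulr1 ?natrK // => i.
  by rewrite ltn_ord.
clearbody t.
exists (fun i : 'I_q => t i.+1 - t i)%N => [|i]; last first.
  rewrite natrB //; have /andP[] := tE i; have /andP[] := tE i.+1.
  rewrite YS -!natr1 => *; rewrite ler_norml; apply/andP; split; lra.
have H n : (n <= q)%N -> (\sum_(i < q | i < n) (t i.+1 - t i) = t n)%N.
  elim: n => [|n IH] nq; first by rewrite big_pred0.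
  rewrite (bigD1 (Ordinal nq)) //= (eq_bigl (fun i : 'I_q => (i < n)%N)).
    rewrite IH; last exact: ltnW.
    by rewrite subnK // (tS (Ordinal nq)).
  by move=> l; rewrite ltnS [RHS]ltn_neqAle andbC.
by rewrite -[RHS]tq -H //; apply: eq_bigl => i; rewrite ltn_ord.
Qed.

Lemma proportional_coloring (V K : finType) (p : V -> K) (y : K -> 'I_q -> R) :
  (0 < q)%N -> (forall a i, 0 <= y a i) -> (forall a, \sum_i y a i = 1) ->
  exists phi : {ffun V -> 'I_q}, forall a i,
    `|#|[set u | (p u, phi u) == (a, i)]|%:R - y a i * (part_size p a)%:R| <= 1.
Proof.
move=> q0 y0 y1.
have : forall a, exists phi : {ffun V -> 'I_q}, forall i,
    `|#|[set u | (p u, phi u) == (a, i)]|%:R - y a i * (part_size p a)%:R| <= 1.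
  move=> a; have [m sm mP] := round_distribution (part_size p a) (y0 a) (y1 a).
  have [psi psim _] := recolor [ffun _ => Ordinal q0] sm.
  exists psi => i; rewrite (_ : #|_| = m i) // -psim.
  by apply: eq_card => u; rewrite !inE xpair_eqE.
move=> /fin_all_exists[F FP].
exists [ffun u => F (p u) u] => a i.
rewrite (_ : #|_| = #|[set u | (p u, F a u) == (a, i)]|) //.
apply: eq_card => u; rewrite !inE !xpair_eqE ffunE.
by case: eqVneq => // ->.
Qed.

End Rounding.

(** * The energy through class densities *)

Section StepFunction.
Variables (R : realFieldType) (L : finType).

Definition class_density (V : finType) (c : V -> L) (l : L) : R :=
  (part_size c l)%:R / #|V|%:R.

Lemma sum_color (V : finType) (c : V -> L) (F : L -> R) :
  \sum_u F (c u) = \sum_l (part_size c l)%:R * F l.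
Proof.
rewrite (partition_big c xpredT) //=; apply: eq_bigr => l _.
by rewrite -part_sum; apply: eq_bigr => u /eqP ->.
Qed.

Lemma class_density_sum1 (V : finType) (c : V -> L) :
  (0 < #|V|)%N -> \sum_l class_density c l = 1.
Proof.
move=> V0; rewrite -mulr_suml.
have := sum_color c (fun=> 1); under [in RHS]eq_bigr => l _ do rewrite mulr1.
move=> <-; rewrite sumr_const divff // pnatr_eq0 -lt0n; exact: V0.
Qed.

Lemma class_density_ge0 (V : finType) (c : V -> L) l : 0 <= class_density c l.
Proof. by rewrite divr_ge0. Qed.

Lemma step_sum (V : finType) (c : V -> L) (D : L -> L -> R) :
  (0 < #|V|)%N ->
  \sum_u \sum_v D (c u) (c v) = #|V|%:R ^+ 2 *
    \sum_l \sum_l' D l l' * (class_density c l * class_density c l').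
Proof.
move=> V0.
rewrite (sum_color c (fun l => \sum_v D l (c v))) mulr_sumr.
apply: eq_bigr => l _; rewrite (sum_color c (D l)) !mulr_sumr.
apply: eq_bigr => l' _; rewrite /class_density; field.
by rewrite pnatr_eq0 -lt0n.
Qed.

(** A quadratic form is Lipschitz in the l1 norm on probability vectors. *)
Lemma step_sum_close (D : L -> L -> R) (B sigma : R) (w w' : L -> R) :
  (forall l l', `|D l l'| <= B) ->
  (forall l, 0 <= w l) -> (forall l, 0 <= w' l) ->
  \sum_l w l = 1 -> \sum_l w' l = 1 -> \sum_l `|w l - w' l| <= sigma ->
  `|\sum_l \sum_l' D l l' * (w l * w l') -
    \sum_l \sum_l' D l l' * (w' l * w' l')| <= 2 * B * sigma.
Proof.
move=> DB w0 w'0 w1 w'1 ws.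
have [B0|Bneg] := lerP 0 B; last first.
  have E (v : L -> R) : \sum_l v l = 1 -> exists l : L, true.
    move=> v1; apply/existsP/existsPn => H; move: v1; rewrite big1 => [|l].
      by move/eqP; rewrite eq_sym oner_eq0.
    by have := H l.
  have [l _] := E w w1; have := le_trans (normr_ge0 _) (DB l l); lra.
rewrite -sumrB.
apply: le_trans (_ : _ <= \sum_l \sum_l'
    B * (`|w l - w' l| * w l' + w' l * `|w l' - w' l'|)) _.
  apply: le_trans (ler_norm_sum _ _ _) _; apply: ler_sum => l _.
  rewrite -sumrB; apply: le_trans (ler_norm_sum _ _ _) _; apply: ler_sum => l' _.
  rewrite -mulrBr normrM ler_pM //.
  rewrite (_ : w l * w l' - _ = (w l - w' l) * w l' + w' l * (w l' - w' l')).
    by apply: le_trans (ler_normD _ _) _; rewrite !normrM (ger0_norm (w0 l'))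
      (ger0_norm (w'0 l)).
  by ring.
have -> : \sum_l \sum_l' B * (`|w l - w' l| * w l' + w' l * `|w l' - w' l'|) =
    2 * B * \sum_l `|w l - w' l|.
  transitivity (\sum_l B * (`|w l - w' l| + w' l * \sum_l `|w l - w' l|)).
    apply: eq_bigr => l _; rewrite -mulr_sumr big_split /= -!mulr_sumr w1 mulr1.
    by [].
  rewrite -mulr_sumr big_split /= -mulr_suml w'1; ring.
by rewrite ler_wpM2l // mulr_ge0.
Qed.

End StepFunction.

Section EnergyComparison.
Variables (R : realType) (q : nat) (J : 'M[R]_q).

Definition entry_bound : R := \sum_i \sum_j `|J i j|.

Lemma entry_bound_ge0 : 0 <= entry_bound.
Proof. by apply: sumr_ge0 => i _; apply: sumr_ge0. Qed.

Lemma entry_le i j : `|J i j| <= entry_bound.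
Proof.
rewrite /entry_bound (bigD1 i) //= (bigD1 j) //= -addrA lerDl.
by rewrite addr_ge0 ?sumr_ge0 // => *; rewrite sumr_ge0.
Qed.

Lemma energyE (G : sgraph) (phi : {ffun G -> 'I_q}) :
  energy J phi =
  - (\sum_u \sum_v (adj u v)%:R * J (phi u) (phi v)) / #|G|%:R ^+ 2.
Proof.
rewrite /energy /edge_sum.
have -> : \sum_(u : G) \sum_(v | adj u v) J (phi u) (phi v) =
   \sum_u \sum_v (adj u v)%:R * J (phi u) (phi v).
  apply: eq_bigr => u _; rewrite big_mkcond; apply: eq_bigr => v _.
  by case: (adj u v); rewrite ?mul1r ?mul0r.
set s := \sum_u _; set n := (_ ^+ 2)^-1.
by rewrite -/n; field.
Qed.

(** The sum splits into one bilinear form of [U] for every pair of colors. *)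
Lemma residual_energy (V : finType) (U : V -> V -> R) (phi : V -> 'I_q) (tau : R) :
  0 <= tau -> c4 U <= tau ^+ 4 * #|V|%:R ^+ 4 ->
  `|\sum_u \sum_v U u v * J (phi u) (phi v)| <= entry_bound * (tau * #|V|%:R ^+ 2).
Proof.
move=> tau0 c4U.
have -> : \sum_u \sum_v U u v * J (phi u) (phi v) =
  \sum_i \sum_j J i j *
    \sum_u \sum_v U u v * ((phi u == i)%:R * (phi v == j)%:R).
  under [RHS]eq_bigr => i _ do under eq_bigr => j _ do
    (rewrite mulr_sumr; under eq_bigr => u _ do rewrite mulr_sumr).
  under [RHS]eq_bigr => i _ do rewrite exchange_big.
  rewrite [RHS]exchange_big; apply: eq_bigr => u _ /=.
  under [RHS]eq_bigr => i _ do rewrite exchange_big.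
  rewrite [RHS]exchange_big; apply: eq_bigr => v _ /=.
  rewrite (bigD1 (phi u)) //= (bigD1 (phi v)) //= !eqxx.
  rewrite !big1 => [||j /negPf jv].
  - by rewrite !addr0 /= !mulr1 mulrC.
  - move=> i /negPf iu; rewrite big1 // => j _.
    by rewrite eq_sym iu mul0r !mulr0.
  - by rewrite [phi v == j]eq_sym jv !mulr0.
rewrite /entry_bound mulr_suml.
apply: le_trans (ler_norm_sum _ _ _) _; apply: ler_sum => i _.
rewrite mulr_suml.
apply: le_trans (ler_norm_sum _ _ _) _; apply: ler_sum => j _.
rewrite normrM ler_wpM2l //.
have ind (b : bool) : `|b%:R| <= 1 :> R by case: b; rewrite ?normr1 ?normr0.
have := cut_le_c4 U (fun x => ind (phi x == i)) (fun x => ind (phi x == j)).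
set s := \sum_x _ => s4.
rewrite -(@ler_pXn2r _ 4) ?nnegrE ?mulr_ge0 //.
rewrite -normrX ger0_norm ?exprn_even_ge0 //; apply: le_trans s4 _.
apply: le_trans (ler_wpM2l _ c4U) _; first exact: exprn_ge0.
by rewrite le_eqVlt; apply/orP; left; apply/eqP; ring.
Qed.

(** A pair (part, color) is the finest class of vertices that the block
densities and the coloring can distinguish. *)
Lemma energy_step (G : sgraph) (K : finType) (p : G -> K) (d : K -> K -> R)
    (phi : {ffun G -> 'I_q}) (tau : R) :
  (0 < #|G|)%N -> 0 <= tau ->
  c4 (residual (@adj G) p d) <= tau ^+ 4 * #|G|%:R ^+ 4 ->
  `|energy J phi + \sum_(l : K * 'I_q) \sum_(l' : K * 'I_q)
      d l.1 l'.1 * J l.2 l'.2 *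
        (class_density R (fun u => (p u, phi u)) l *
         class_density R (fun u => (p u, phi u)) l')| <= entry_bound * tau.
Proof.
move=> G0 tau0 c4U.
have n0 : 0 < #|G|%:R ^+ 2 :> R by rewrite exprn_gt0 // ltr0n.
have := residual_energy phi tau0 c4U.
set s := \sum_u _; set t := \sum_l _ => sle.
have -> : energy J phi + t = - (s / #|G|%:R ^+ 2); last first.
  by rewrite normrN normrM normfV (gtr0_norm n0) ler_pdivrMr // -mulrA.
have -> : s = \sum_u \sum_v (adj u v)%:R * J (phi u) (phi v) - #|G|%:R ^+ 2 * t.
  rewrite /t -(step_sum (fun u => (p u, phi u))
    (fun l l' => d l.1 l'.1 * J l.2 l'.2) G0) -sumrB.
  apply: eq_bigr => u _; rewrite -sumrB; apply: eq_bigr => v _ /=.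
  by rewrite /residual; ring.
by rewrite energyE; field; rewrite -sqrf_eq0 gt_eqF.
Qed.

Lemma energy_compare (G H : sgraph) (K : finType) (p : G -> K) (p' : H -> K)
    (d : K -> K -> R) (phi : {ffun G -> 'I_q}) (psi : {ffun H -> 'I_q})
    (tau sigma : R) :
  (0 < #|G|)%N -> (0 < #|H|)%N -> 0 <= tau ->
  (forall a b, 0 <= d a b <= 1) ->
  c4 (residual (@adj G) p d) <= tau ^+ 4 * #|G|%:R ^+ 4 ->
  c4 (residual (@adj H) p' d) <= tau ^+ 4 * #|H|%:R ^+ 4 ->
  \sum_l `|class_density R (fun u => (p u, phi u)) l -
      class_density R (fun u => (p' u, psi u)) l| <= sigma ->
  `|energy J phi - energy J psi| <= 2 * entry_bound * (tau + sigma).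
Proof.
move=> G0 H0 tau0 d01 cG cH ws.
have eG := energy_step phi G0 tau0 cG.
have eH := energy_step psi H0 tau0 cH.
have dJ (l l' : K * 'I_q) : `|d l.1 l'.1 * J l.2 l'.2| <= entry_bound.
  have /andP[d0 d1] := d01 l.1 l'.1.
  rewrite normrM (ger0_norm d0); apply: le_trans (entry_le l.2 l'.2).
  by rewrite ler_piMl.
have := step_sum_close dJ (class_density_ge0 _ _) (class_density_ge0 _ _)
  (class_density_sum1 _ _ G0) (class_density_sum1 _ _ H0) ws.
move: eG eH; set x := \sum_l _; set y := \sum_l _.
rewrite !ler_norml => /andP[? ?] /andP[? ?] /andP[? ?]; apply/andP; split; lra.
Qed.

Lemma energy_recolor (G : sgraph) (phi psi : {ffun G -> 'I_q}) :
  (0 < #|G|)%N ->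
  energy J psi <= energy J phi +
   4 * entry_bound * (#|[set u | psi u != phi u]|%:R / #|G|%:R).
Proof.
move=> G0; have n0 : 0 < #|G|%:R :> R by rewrite ltr0n.
set m := #|_|%:R; pose b u : R := (psi u != phi u)%:R.
have sb : \sum_u b u = m by rewrite (sum_indicator _ xpredT).
have B0 := entry_bound_ge0.
rewrite -lerBlDl !energyE -mulrBl ler_pdivrMr ?exprn_gt0 //.
apply: le_trans (_ : _ <= \sum_u \sum_v 2 * entry_bound * (b u + b v)) _.
  rewrite opprK addrC -sumrB; apply: ler_sum => u _.
  rewrite -sumrB; apply: ler_sum => v _.
  have /andP[? ?] : - entry_bound <= J (phi u) (phi v) <= entry_bound.
    by rewrite -ler_norml entry_le.
  have : - entry_bound <= J (psi u) (psi v) <= entry_bound.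
    by rewrite -ler_norml entry_le.
  rewrite /b; case: (eqVneq (psi u) (phi u)) => [->|_] /andP[]; last first.
    by case: (adj u v); case: (psi v != phi v) => /= *; lra.
  by case: (eqVneq (psi v) (phi v)) => [->|_]; case: (adj u v) => /= *; lra.
have -> : \sum_u \sum_v 2 * entry_bound * (b u + b v) =
    4 * entry_bound * (m * #|G|%:R).
  transitivity (\sum_u 2 * entry_bound * (b u * #|G|%:R + m)).
    apply: eq_bigr => u _; rewrite -mulr_sumr big_split /= sb sumr_const.
    by rewrite mulr_natr.
  rewrite -mulr_sumr big_split /= -mulr_suml sb sumr_const -[m *+ _]mulr_natr.
  by ring.
rewrite le_eqVlt; apply/orP; left; apply/eqP; field.
by rewrite gt_eqF.
Qed.

End EnergyComparison.

(** * The ground state as a minimum over balanced colorings *)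

Section GroundState.
Variables (R : realType) (q : nat) (c : R) (J : 'M[R]_q).
Hypotheses (q_gt0 : (0 < q)%N) (c_le : c <= 1 / q%:R).

(** Besides nonemptiness, this gives a nearby element of [Omega a G] for any
coloring whose classes almost have the sizes prescribed by [a]. *)
Lemma Omega_approximation (a : 'I_q -> R) (G : sgraph) (phi0 : {ffun G -> 'I_q}) :
  Pd a -> exists2 phi : {ffun G -> 'I_q}, Omega a phi &
    (#|[set u | phi u != phi0 u]|%:R <=
      \sum_i `|#|color_class phi0 i|%:R - a i * #|G|%:R| + q%:R).
Proof.
move=> [a0 a1].
have [m sm mP] := round_distribution #|G| a0 a1.
have [phi phim chg] := recolor (D := [set: G]) phi0 (etrans sm (esym (cardsT _))).
have toT (P : pred G) : #|[set u in [set: G] | P u]| = #|[set u | P u]|.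
  by apply: eq_card => u; rewrite !inE.
exists phi => [i|].
  by move: (phim i); rewrite toT /color_class => ->.
rewrite toT in chg.
apply: (@le_trans _ _ (\sum_(i < q) (#|[set u in [set: G] | phi0 u == i]| - m i)%N%:R)).
  by rewrite -natr_sum ler_nat.
have -> : q%:R = \sum_(i < q) 1 :> R by rewrite sumr_const card_ord.
rewrite -big_split /=.
apply: ler_sum => i _; rewrite toT -/(color_class phi0 i).
have := mP i; set x := _ * _; rewrite ler_norml => /andP[? ?].
have [le|lt] := leqP #|color_class phi0 i| (m i).
  by rewrite (eqP le) addr_ge0.
rewrite natrB ?(ltnW lt) //.
have := ler_norm (#|color_class phi0 i|%:R - x); rewrite /=; lra.
Qed.

Lemma threshold_nonempty : threshold_set c (fun _ : 'I_q => 1 / q%:R).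
Proof.
split=> //; split=> [i|]; first by rewrite divr_ge0.
by rewrite sumr_const card_ord -[LHS]mulr_natr divfK // pnatr_eq0 -lt0n.
Qed.

(** The infimum over distributions of the minima over colorings is the minimum
over the finite set of balanced colorings; nonemptiness of every [Omega a G] is
essential, as the infimum of the empty set is 0. *)
Lemma ground_state (G : sgraph) :
  (exists2 phi : {ffun G -> 'I_q}, balanced c phi &
     lower_threshold_energy c J G = energy J phi) /\
  (forall phi : {ffun G -> 'I_q}, balanced c phi ->
     lower_threshold_energy c J G <= energy J phi).
Proof.
pose P (phi : {ffun G -> 'I_q}) := asbool (balanced c phi).
have [phi0 ex0 _] := Omega_approximation [ffun _ : G => Ordinal q_gt0] threshold_nonempty.1.
have P0 : P phi0 by apply/asboolP; exists (fun _ => 1 / q%:R) => //; exact: threshold_nonempty.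
have [phi /asboolP bphi min] := arg_minP (fun phi => energy J phi) P0.
have minb (psi : {ffun G -> 'I_q}) : balanced c psi -> energy J phi <= energy J psi.
  by move=> b; apply: min; apply/asboolP.
have [a0 a0c a0phi] := bphi.
have micro_ge a : threshold_set c a -> energy J phi <= microcanonical_energy a G J.
  move=> ac; apply: lb_le_inf.
    have [psi psia _] := Omega_approximation phi ac.1.
    by exists (energy J psi), psi.
  by move=> _ [psi psia <-]; apply: minb; exists a.
suff E : lower_threshold_energy c J G = energy J phi.
  by split=> [|psi /minb]; [exists phi | rewrite E].
apply/le_anti/andP; split; last first.
  apply: lb_le_inf; first by exists (microcanonical_energy a0 G J), a0.
  by move=> _ [a ac <-]; exact: micro_ge.
apply: (@le_trans _ _ (microcanonical_energy a0 G J)).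
  apply: ge_inf; last by exists a0.
  by exists (energy J phi) => _ [a ac <-]; exact: micro_ge.
apply: ge_inf; last by exists phi.
by exists (energy J phi) => _ [psi psia <-]; apply: minb; exists a0.
Qed.

End GroundState.

(** * Comparing two graphs with similar partitions *)

Section Transfer.
Variables (R : realType) (q : nat) (c : R) (J : 'M[R]_q).
Hypotheses (q_gt0 : (0 < q)%N) (c_le : c <= 1 / q%:R).

Lemma sum_classes_color (V K : finType) (p : V -> K) (phi : V -> 'I_q) (i : 'I_q) :
  #|[set u | phi u == i]|%:R = \sum_a (part_size (fun u => (p u, phi u)) (a, i))%:R :> R.
Proof.
rewrite -(sum_class _ p) natr_sum; apply: eq_bigr => a _; congr (_%:R).
by apply: eq_card => u; rewrite !inE xpair_eqE andbC.
Qed.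

(** Every part of [V] is colored in the proportions of the corresponding part of
[W], up to rounding. *)
Lemma copy_coloring (V W K : finType) (p : V -> K) (p' : W -> K)
    (psi : W -> 'I_q) (delta : R) :
  (0 < #|V|)%N -> (0 < #|W|)%N ->
  (forall a, `|class_density R p a - class_density R p' a| <= delta) ->
  exists phi : {ffun V -> 'I_q}, forall l,
    `|class_density R (fun u => (p u, phi u)) l -
      class_density R (fun u => (p' u, psi u)) l| <= delta + #|V|%:R^-1.
Proof.
move=> V0 W0 pp'.
have v0 : 0 < #|V|%:R :> R by rewrite ltr0n.
have w0 : 0 < #|W|%:R :> R by rewrite ltr0n.
pose N a i : R := (part_size (fun u => (p' u, psi u)) (a, i))%:R.
have sN a : \sum_i N a i = (part_size p' a)%:R.
  rewrite /part_size -(sum_class _ psi) natr_sum; apply: eq_bigr => i _.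
  by congr (_%:R); apply: eq_card => u; rewrite !inE xpair_eqE.
(* Parts that are empty in [W] are small in [V]; any distribution does there. *)
pose y a i : R := if part_size p' a == 0%N then 1 / q%:R else N a i / (part_size p' a)%:R.
have y0 a i : 0 <= y a i by rewrite /y; case: ifP => _; rewrite divr_ge0.
have y1 a : \sum_i y a i = 1.
  rewrite /y; case: eqVneq => [_|P0].
    by rewrite sumr_const card_ord -[LHS]mulr_natr divfK // pnatr_eq0 -lt0n.
  by rewrite -mulr_suml sN divff // pnatr_eq0.
have yle a i : y a i <= 1.
  by rewrite -(y1 a) (bigD1 i) //= lerDl sumr_ge0.
have yN a i : N a i = y a i * (part_size p' a)%:R.
  rewrite /y; case: eqVneq => [P0|P0]; last by rewrite divfK // pnatr_eq0.
  have z : \sum_j N a j = 0 by rewrite sN P0.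
  by rewrite P0 mulr0 (psumr_eq0P _ z) // => j _; rewrite /N.
have [phi phiP] := proportional_coloring p q_gt0 y0 y1.
exists phi => -[a i]; rewrite /class_density -/(N a i) yN.
have := phiP a i; rewrite -/(part_size (fun u => (p u, phi u)) (a, i)).
set P := part_size _ (a, i); set x := y a i.
move=> h1; have := pp' a; rewrite /class_density.
set s := (part_size p a)%:R; set s' := (part_size p' a)%:R => h2.
have -> : P%:R / #|V|%:R - x * s' / #|W|%:R =
   (P%:R - x * s) / #|V|%:R + x * (s / #|V|%:R - s' / #|W|%:R) by ring.
apply: le_trans (ler_normD _ _) _; rewrite addrC lerD //.
  rewrite normrM (ger0_norm (y0 a i)); apply: le_trans h2.
  by rewrite ler_piMl // yle.
by rewrite normrM (gtr0_norm (x := _^-1)) ?invr_gt0 // ler_piMl // invr_ge0 ltW.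
Qed.

(** The terms of the error: [2 * tau] for the residuals, [M * q * (delta + x)]
for the l1 distance of the class densities, which counts twice in the
comparison of energies and four times in the number of recolored vertices, and
[8 * q * x] for the rounding of class sizes in both graphs. *)
Lemma ground_state_transfer (G H : sgraph) (K : finType) (p : G -> K)
    (p' : H -> K) (d : K -> K -> R) (tau delta x : R) (M : nat) :
  (0 < #|G|)%N -> (0 < #|H|)%N -> #|G|%:R^-1 <= x -> #|H|%:R^-1 <= x ->
  0 <= tau -> (#|K| <= M)%N ->
  (forall a b, 0 <= d a b <= 1) ->
  c4 (residual (@adj G) p d) <= tau ^+ 4 * #|G|%:R ^+ 4 ->
  c4 (residual (@adj H) p' d) <= tau ^+ 4 * #|H|%:R ^+ 4 ->
  (forall a, `|class_density R p a - class_density R p' a| <= delta) ->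
  0 <= delta ->
  lower_threshold_energy c J G <= lower_threshold_energy c J H +
    entry_bound J * (2 * tau + 6 * (M%:R * q%:R * (delta + x)) + 8 * q%:R * x).
Proof.
move=> G0 H0 Gx Hx tau0 KM d01 cG cH pp' delta0.
have g0 : 0 < #|G|%:R :> R by rewrite ltr0n.
have h0 : 0 < #|H|%:R :> R by rewrite ltr0n.
have B0 := entry_bound_ge0 J.
have x0 : 0 <= x by apply: le_trans Gx; rewrite invr_ge0 ltW.
have [[psi [a ac apsi] ->] _] := ground_state J q_gt0 c_le H.
have [_ minG] := ground_state J q_gt0 c_le G.
have [phi0 close] := copy_coloring psi G0 H0 pp'.
set sigma := M%:R * q%:R * (delta + x).
set w := class_density R _ in close; set w' := class_density R _ in close.
have ws : \sum_l `|w l - w' l| <= sigma.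
  apply: le_trans (_ : _ <= \sum_(l : K * 'I_q) (delta + x)) _.
    apply: ler_sum => l _; apply: le_trans (close l) _.
    by rewrite lerD2l.
  rewrite sumr_const card_prod card_ord -mulr_natl natrM ler_wpM2r ?addr_ge0 //.
  by rewrite ler_wpM2r // ler_nat.
have [phi aphi chg] := Omega_approximation phi0 ac.1.
have dev : \sum_i `|#|color_class phi0 i|%:R - a i * #|G|%:R| <=
    #|G|%:R * (sigma + q%:R * x).
  apply: le_trans (_ : _ <= \sum_i #|G|%:R * (\sum_b `|w (b, i) - w' (b, i)| + x)) _.
    apply: ler_sum => i _.
    have -> : #|color_class phi0 i|%:R - a i * #|G|%:R = #|G|%:R *
        (\sum_b (w (b, i) - w' (b, i)) +
         (#|color_class psi i|%:R - a i * #|H|%:R) / #|H|%:R).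
      rewrite sumrB /w /w' /class_density -!mulr_suml -!sum_classes_color.
      by rewrite /color_class; field; rewrite !gt_eqF.
    rewrite normrM (gtr0_norm g0) ler_wpM2l ?(ltW g0) //.
    apply: le_trans (ler_normD _ _) _; apply: lerD; first exact: ler_norm_sum.
    apply: le_trans Hx; rewrite normrM (gtr0_norm (x := _^-1)) ?invr_gt0 //.
    by rewrite ler_piMl ?invr_ge0 ?(ltW h0) ?apsi.
  rewrite -mulr_sumr ler_wpM2l ?(ltW g0) // big_split /=; apply: lerD.
    rewrite exchange_big /= pair_big /=; apply: le_trans ws.
    by rewrite le_eqVlt; apply/orP; left; apply/eqP; apply: eq_bigr => -[].
  by rewrite sumr_const card_ord -[_ *+ q]mulr_natl.
apply: le_trans (minG phi _) _; first by exists a.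
apply: le_trans (energy_recolor J phi0 phi G0) _.
have := energy_compare J (phi := phi0) (psi := psi) G0 H0 tau0 d01 cG cH ws.
rewrite ler_norml => /andP[_ cmp].
have ch : #|[set u | phi u != phi0 u]|%:R / #|G|%:R <= sigma + 2 * q%:R * x.
  rewrite ler_pdivrMr //; apply: le_trans chg _.
  have : q%:R <= q%:R * x * #|G|%:R.
    rewrite -mulrA ler_peMr //; move: Gx; rewrite -[X in X <= _]mul1r ler_pdivrMr //.
  by move: dev; lra.
have := ler_wpM2l B0 ch; lra.
Qed.

End Transfer.

(** * Testability *)

Lemma markov (R : realFieldType) (I : finType) (D : {set I}) (F : I -> R) (t : R) :
  (forall i, 0 <= F i) ->
  #|[set i in D | t < F i]|%:R * t <= \sum_(i in D) F i.
Proof.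
move=> F0; rewrite mulr_natl -sumr_const.
rewrite [leRHS](bigID (fun i => t < F i)) /= -[leLHS]addr0 lerD ?sumr_ge0 //.
rewrite (eq_bigl (fun i => (i \in D) && (t < F i))); last by move=> i; rewrite inE.
by apply: ler_sum => i /andP[_ /ltW].
Qed.

Section InducedSample.
Variables (R : realType) (G : sgraph).

Lemma card_induced (S : {set G}) : #|induced S| = #|S|.
Proof. by rewrite card_sig; apply: eq_card => x; rewrite inE. Qed.

Lemma part_size_induced (K : finType) (p : G -> K) (S : {set G}) (a : K) :
  part_size (fun x : induced S => p (val x)) a = #|[set x in S | p x == a]|.
Proof.
rewrite /part_size -!sum1_card; under eq_bigl => x do rewrite inE.
under [RHS]eq_bigl => x do rewrite inE.
by rewrite [RHS]big_sub_cond.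
Qed.

Lemma c4_induced (K : finType) (p : G -> K) (d : K -> K -> R) (S : {set G}) :
  c4 (residual (@adj (induced S)) (fun x => p (val x)) d) =
  c4 (fun x y : {x | x \in S} => residual (@adj G) p d (val x) (val y)).
Proof. by []. Qed.

(** Markov's inequality for [c4] and Chebyshev's inequality for each of the at
most [M] parts, combined by a union bound. *)
Lemma sample_bad_le (K : finType) (p : G -> K) (k M : nat) (eta theta delta : R) :
  (0 < k)%N -> (k <= #|G|)%N -> (#|K| <= M)%N ->
  0 < theta -> 0 < delta ->
  c4 (residual (@adj G) p (density R (@adj G) p)) <= eta * #|G|%:R ^+ 4 ->
  #|[set S in samples G k | ~~
    ((c4 (residual (@adj (induced S)) (fun x => p (val x)) (density R (@adj G) p))
       <= theta * k%:R ^+ 4) &&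
     [forall a, `|class_density R p a -
        class_density R (fun x : induced S => p (val x)) a| <= delta])]|%:R <=
  ((eta + 12 / k%:R) / theta + M%:R / (k%:R * delta ^+ 2)) * #|samples G k|%:R.
Proof.
move=> k0 kG KM theta0 delta0 cG.
have kR0 : 0 < k%:R :> R by rewrite ltr0n.
set d := density R (@adj G) p in cG *; set N := #|samples G k|%:R : R.
have U1 x y : `|residual (@adj G) p d x y| <= 1.
  by apply: residual_le1 => a b; rewrite density_ge0 density_le1.
pose C (S : {set G}) := c4 (fun x y : {x | x \in S} => residual (@adj G) p d (val x) (val y)).
pose X a (S : {set G}) : R :=
  (#|[set x in S | p x == a]|%:R - k%:R * (#|[set x | p x == a]|%:R / #|G|%:R)) ^+ 2.
pose B1 := [set S in samples G k | theta * k%:R ^+ 4 < C S].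
pose B2 a := [set S in samples G k | (delta * k%:R) ^+ 2 < X a S].
set B := [set S in _ | _].
have sub : B \subset B1 :|: \bigcup_a B2 a.
  apply/subsetP => S; rewrite !inE => /andP[Sk]; rewrite Sk negb_and => /orP[|].
    by rewrite -ltNge c4_induced => ->.
  rewrite negb_forall => /existsP[a]; rewrite -ltNge => dev.
  apply/orP; right; apply/bigcupP; exists a => //; rewrite !inE Sk /=.
  move: dev; rewrite /class_density part_size_induced card_induced (eqP Sk).
  rewrite -/(part_size p a) distrC => dev; rewrite /X.
  have -> : #|[set x in S | p x == a]|%:R -
      k%:R * (#|[set x | p x == a]|%:R / #|G|%:R) =
      k%:R * (#|[set x in S | p x == a]|%:R / k%:R - (part_size p a)%:R / #|G|%:R) :> R.
    by rewrite /part_size mulrBr [in RHS]mulrCA divff ?mulr1 // gt_eqF.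
  rewrite !exprMn [ltRHS]mulrC ltr_pM2r ?exprn_gt0 //.
  rewrite -[ltRHS]real_normK ?num_real //.
  by rewrite ltr_pXn2r ?nnegrE ?normr_ge0 ?(ltW delta0).
have le1 : #|B1|%:R <= (eta + 12 / k%:R) / theta * N.
  have := markov (samples G k) (theta * k%:R ^+ 4) (fun S => c4_ge0 _ : 0 <= C S).
  move=> /le_trans/(_ (c4_sample k0 kG U1 cG)); rewrite -/N -/B1.
  rewrite -ler_pdivlMr ?mulr_gt0 ?exprn_gt0 // => /le_trans; apply.
  by rewrite le_eqVlt; apply/orP; left; apply/eqP; field; rewrite !gt_eqF.
have le2 a : #|B2 a|%:R <= N / (k%:R * delta ^+ 2).
  have := markov (samples G k) ((delta * k%:R) ^+ 2) (fun S => sqr_ge0 _ : 0 <= X a S).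
  move=> /le_trans/(_ (sample_deviation R k0 kG (fun x => p x == a))).
  rewrite -/N -/(B2 a) -ler_pdivlMr ?exprn_gt0 ?mulr_gt0 // => /le_trans; apply.
  by rewrite le_eqVlt; apply/orP; left; apply/eqP; field; rewrite !gt_eqF.
have le3 : (#|B| <= #|B1| + \sum_a #|B2 a|)%N.
  apply: leq_trans (subset_leq_card sub) _; apply: leq_trans (leq_card_setU _ _) _.
  rewrite leq_add2l; elim/big_ind2: _ => // [|A n A' n' An An'].
    by rewrite cards0.
  by apply: leq_trans (leq_card_setU _ _) _; exact: leq_add.
have t0 : 0 <= N / (k%:R * delta ^+ 2) by rewrite divr_ge0 // mulr_ge0 ?exprn_ge0 ?ltW.
apply: le_trans (_ : _ <= (#|B1| + \sum_a #|B2 a|)%N%:R) _; first by rewrite ler_nat.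
rewrite natrD natr_sum mulrDl lerD //.
apply: le_trans (ler_sum _ (fun a _ => le2 a)) _.
rewrite sumr_const -[leLHS]mulr_natl mulrAC -mulrA ler_wpM2r //.
by rewrite ler_nat.
Qed.

End InducedSample.

Section Testability.
Variables (R : realType) (q : nat) (c : R) (J : 'M[R]_q).
Hypotheses (q_gt0 : (0 < q)%N) (c_le : c <= 1 / q%:R).

Lemma nat_above (x : R) : exists2 n : nat, (0 < n)%N & x <= n%:R.
Proof.
exists (Num.truncn x).+1 => //.
by have := truncnS_gt x; exact: ltW.
Qed.

(** The constants are chosen in the order [tau], [theta], [eta], [m], [delta],
[k]: the regularity parameter [eta] fixes the number [M] of parts, and only
then can the tolerance [delta] for each part and the sample size be chosen. *)
Lemma threshold_energy_testable : testable (lower_threshold_energy c J).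
Proof.
move=> eps eps0.
(* The summand 1 only serves to make the bound positive. *)
pose B := entry_bound J + 1.
have B0 : 0 < B by rewrite ltr_wpDl ?entry_bound_ge0.
have qR : 0 < q%:R :> R by rewrite ltr0n.
pose tau := eps / (8 * B).
have tau0 : 0 < tau by rewrite divr_gt0 // mulr_gt0.
pose theta := tau ^+ 4.
have theta0 : 0 < theta by rewrite exprn_gt0.
pose e := Num.min eps 1.
have e0 : 0 < e by rewrite lt_min eps0 ltr01.
have ee : e <= eps by rewrite ge_min lexx.
have e1 : e <= 1 by rewrite ge_min lexx orbT.
pose eta := theta * e / 8.
have eta0 : 0 < eta by rewrite divr_gt0 // mulr_gt0.
have [m m0 mP] := nat_above (2 / eta ^+ 2).
have meta : 1 < m%:R * eta ^+ 2.
  by move: mP; rewrite ler_pdivrMr ?exprn_gt0 // => mP; lra.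
pose M := (4 ^ m)%N.
have MR : 0 < M%:R :> R by rewrite ltr0n expn_gt0.
pose delta := eps / (48 * B * M%:R * q%:R).
have delta0 : 0 < delta by rewrite divr_gt0 // !mulr_gt0.
pose T1 := (6 * M%:R * q%:R + 8 * q%:R) * 8 * B / eps.
pose T2 := 96 / (theta * e).
pose T3 := 4 * M%:R / (delta ^+ 2 * e).
have [k k0 kP] := nat_above (T1 + T2 + T3).
have kR : 0 < k%:R :> R by rewrite ltr0n.
have T1p : 0 < T1 by rewrite divr_gt0 // !mulr_gt0 // addr_gt0 // !mulr_gt0.
have T2p : 0 < T2 by rewrite divr_gt0 ?(mulr_gt0 theta0 e0) ?ltr0n.
have T3p : 0 < T3.
  by apply: divr_gt0; apply: mulr_gt0; rewrite ?exprn_gt0 ?ltr0n ?expn_gt0.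
have b1 : B * (6 * M%:R * q%:R + 8 * q%:R) * k%:R^-1 <= eps / 8.
  have : T1 <= k%:R by lra.
  rewrite /T1 ler_pdivrMr // => h; rewrite ler_pdivrMr //; lra.
have b2 : 12 / k%:R / theta <= e / 8.
  have : T2 <= k%:R by lra.
  rewrite /T2 (ler_pdivrMr _ _ (mulr_gt0 theta0 e0)) => h.
  by rewrite -mulrA -invfM (ler_pdivrMr _ _ (mulr_gt0 kR theta0)); lra.
have b3 : M%:R / (k%:R * delta ^+ 2) <= e / 4.
  have : T3 <= k%:R by lra.
  rewrite /T3 (ler_pdivrMr _ _ (mulr_gt0 (exprn_gt0 2 delta0) e0)) => h.
  by rewrite (ler_pdivrMr _ _ (mulr_gt0 kR (exprn_gt0 2 delta0))); lra.
have b4 : eta / theta = e / 8 by rewrite /eta; field; rewrite gt_eqF.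
have b5 : B * (2 * tau) = eps / 4 by rewrite /tau; field; rewrite gt_eqF.
have b6 : B * (6 * (M%:R * q%:R * delta)) = eps / 8.
  by rewrite /delta; field; rewrite !gt_eqF.
exists k => // G kG.
have G0 : (0 < #|G|)%N by exact: leq_trans kG.
have [K [p [KM cG]]] := regularity (@adj G) eta0 meta.
set d := density R (@adj G) p in cG.
have d01 a b : 0 <= d a b <= 1 by rewrite density_ge0 density_le1.
have bad := sample_bad_le k0 kG KM theta0 delta0 cG.
have N0 : 0 < #|samples G k|%:R :> R.
  by rewrite ltr0n card_samples // bin_gt0.
rewrite /ksubset_prob -/(samples G k) ltr_pdivrMr //.
have sub : [set S : {set G} | (#|S| == k) &&
    (eps < `|lower_threshold_energy c J G - lower_threshold_energy c J (induced S)|)]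
  \subset [set S in samples G k | ~~
    ((c4 (residual (@adj (induced S)) (fun x => p (val x)) d)
       <= theta * k%:R ^+ 4) &&
     [forall a, `|class_density R p a -
        class_density R (fun x : induced S => p (val x)) a| <= delta])].
  apply/subsetP => S; rewrite !inE => /andP[Sk]; rewrite Sk /=.
  apply: contraL => /andP[cS /forallP dS]; rewrite -leNgt.
  have S0 : #|induced S| = k by rewrite card_induced (eqP Sk).
  have kx : #|induced S|%:R^-1 <= k%:R^-1 :> R by rewrite S0.
  have gx : #|G|%:R^-1 <= k%:R^-1 :> R.
    by rewrite lef_pV2 ?posrE ?ltr0n // ler_nat.
  have H0 : (0 < #|induced S|)%N by rewrite S0.
  rewrite -[k in k%:R ^+ 4]S0 in cS.
  have cG' : c4 (residual (@adj G) p d) <= tau ^+ 4 * #|G|%:R ^+ 4.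
    apply: le_trans cG _; rewrite ler_wpM2r ?exprn_ge0 // -/theta /eta.
    by have : theta * e <= theta * 1; [rewrite ler_wpM2l // ltW | lra].
  have dS' a : `|class_density R (fun x : induced S => p (val x)) a -
      class_density R p a| <= delta by rewrite distrC.
  have t1 := ground_state_transfer J q_gt0 c_le G0 H0 gx kx (ltW tau0) KM d01
    cG' cS dS (ltW delta0).
  have t2 := ground_state_transfer J q_gt0 c_le H0 G0 kx gx (ltW tau0) KM d01
    cS cG' dS' (ltW delta0).
  have err : entry_bound J * (2 * tau + 6 * (M%:R * q%:R * (delta + k%:R^-1)) +
      8 * q%:R * k%:R^-1) <= eps.
    apply: le_trans (_ : _ <= B * (2 * tau + 6 * (M%:R * q%:R * (delta + k%:R^-1)) +
      8 * q%:R * k%:R^-1)) _; last by lra.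
    apply: ler_wpM2r; last by rewrite lerDl.
    have x0 : 0 <= k%:R^-1 :> R by rewrite invr_ge0 ltW.
    have dx0 : 0 <= delta + k%:R^-1 by rewrite addr_ge0 // ltW.
    have Mq0 : 0 <= M%:R * q%:R :> R by rewrite mulr_ge0.
    apply: addr_ge0; last by rewrite mulr_ge0 // mulr_ge0.
    by apply: addr_ge0; rewrite mulr_ge0 // ?(ltW tau0) // mulr_ge0.
  by rewrite ler_norml; apply/andP; split; lra.
apply: le_lt_trans (_ : _ <= _) _.
  by apply: le_trans bad; rewrite ler_nat; exact: subset_leq_card.
rewrite ltr_pM2r // mulrDl b4; lra.
Qed.

End Testability.

(** * Multiway cuts as ground states *)

Section MultiwayCut.
Variables (R : realType) (q : nat).

Definition cut_matrix : 'M[R]_q := \matrix_(i, j) (if i == j then 0 else - 2^-1).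

Lemma cut_matrix_sym : cut_matrix^T = cut_matrix.
Proof. by apply/matrixP => i j; rewrite !mxE eq_sym. Qed.

Lemma energy_cut (G : sgraph) (phi : {ffun G -> 'I_q}) :
  energy cut_matrix phi = multiway_cut_density R phi.
Proof.
rewrite energyE /multiway_cut_density; congr (_ / _).
pose E (P : rel 'I_q) := \sum_u \sum_v (adj u v)%:R * (P (phi u) (phi v))%:R : R.
have -> : \sum_(i < q) \sum_(j < q | (i < j)%N)
    (edges_between (color_class phi i) (color_class phi j))%:R = E (fun i j => i < j)%N.
  transitivity (\sum_(i < q) \sum_(j < q | (i < j)%N) \sum_u \sum_v
      (adj u v)%:R * ((phi u == i)%:R * (phi v == j)%:R) : R).
    apply: eq_bigr => i _; apply: eq_bigr => j _.
    rewrite /edges_between -(sum_indicator R xpredT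
      (fun z : G * G => [&& z.1 \in color_class phi i,
        z.2 \in color_class phi j & adj z.1 z.2])).
    rewrite pair_big /=; apply: eq_bigr => -[u v] _ /=; rewrite !inE.
    by rewrite -!natrM !mulnb andbA andbC.
  under eq_bigr => i _ do rewrite exchange_big.
  rewrite exchange_big; apply: eq_bigr => u _ /=.
  under eq_bigr => i _ do rewrite exchange_big.
  rewrite exchange_big; apply: eq_bigr => v _ /=.
  rewrite (bigD1 (phi u)) //= [X in _ + X]big1 ?addr0 => [|i /negPf iu]; last first.
    by rewrite big1 // => j _; rewrite eq_sym iu mul0r mulr0.
  case: ltnP => uv.
    rewrite (bigD1 (phi v)) //= !eqxx !mulr1 big1 ?addr0 // => j /andP[_ /negPf jv].
    by rewrite [phi v == j]eq_sym jv !mulr0.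
  rewrite /= mulr0 big1 // => j uj.
  case: (eqVneq (phi v) j) => [vj|]; last by rewrite /= !mulr0.
  by move: uj; rewrite -vj ltnNge uv.
(* Each unordered pair of classes is counted once in the cut but twice in the
   energy, which explains the factor 1/2 in the matrix. *)
have sym : E (fun i j => j < i)%N = E (fun i j => i < j)%N.
  rewrite /E exchange_big; apply: eq_bigr => u _; apply: eq_bigr => v _.
  by rewrite adj_sym.
rewrite -[RHS]mulr1 -[X in _ * X](divff (x := 2)) ?pnatr_eq0 //.
rewrite mulrA mulr_natr mulr2n -{1}sym /E -big_split mulr_suml -sumrN.
apply: eq_bigr => u _; rewrite -big_split mulr_suml -sumrN.
apply: eq_bigr => v _; rewrite /= mxE -val_eqE.
by case: ltngtP => _; case: (adj u v) => /=; lra.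
Qed.

End MultiwayCut.

Theorem corollary3p3 (R : realType) (q : nat) (hq : (0 < q)%N) (c : R)
    (hc0 : 0 <= c) (hcq : c <= 1 / q%:R) :
  (forall J : 'M[R]_q, J^T = J -> testable (lower_threshold_energy c J)) /\
  (exists2 J : 'M[R]_q, J^T = J &
     forall G : sgraph, (0 < #|G|)%N ->
       is_min_balanced_cut_density q c G (lower_threshold_energy c J G)).
Proof.
split=> [J _|]; first exact: threshold_energy_testable.
exists (cut_matrix R q) => [|G _]; first exact: cut_matrix_sym.
have [[phi bphi E] min] := ground_state (cut_matrix R q) hq hcq G.
split=> [|psi /min]; last by rewrite energy_cut.
by exists phi; rewrite // E energy_cut.
Qed.
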